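(* Let $G=(V,E)$ be a finite undirected multigraph with $n=|V|$ and let $B\subseteq E$ be arbitrary. Suppose $K>0$ is such that $c_e\ge K$ for every $e\in B$. Call a nonempty set $F\subseteq B$ a cut-induced subset of $B$ if $F=\delta(S)\cap B$ for some $S\subseteq V$, and let $q(F)=\min\{|\delta(S)|: S\subseteq V,\ \delta(S)\cap B=F\}$. Then for every real $\alpha\ge 1$, $$\bigl|\{F: F \text{ is a cut-induced subset of } B,\ q(F)\le\alpha K\}\bigr|<n^{2\alpha}.$$
   Context: $\delta(S)$ is the set of all edges (counting parallel copies) with exactly one endpoint in $S$, and $|\cdot|$ counts multiplicity. For an edge $e=st$, the effective conductance $c_e$ is the current flowing from $s$ to $t$ when every edge (copy) is a unit resistor and a unit voltage difference is imposed between $s$ and $t$. *)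

(* Defs.v *)
From HB Require Import structures.
From mathcomp Require Import all_boot all_order all_algebra.
From mathcomp Require Import reals exp.
Set Implicit Arguments. Unset Strict Implicit. Unset Printing Implicit Defensive.
Import Order.TTheory GRing.Theory Num.Theory.
Local Open Scope ring_scope.

(* A finite undirected multigraph: vertex type V, edge type E (each element
   of E is one parallel copy), endpoints src e and dst e (orientation is
   irrelevant to everything below). *)

Section Graph.
Variables (V E : finType) (src dst : E -> V).

Definition delta (S : {set V}) : {set E} :=
  [set e | (src e \in S) != (dst e \in S)].

Definition cut_induced (B F : {set E}) : bool :=
  (F != set0) && [exists S : {set V}, delta S :&: B == F].

(* q(F) = min { |delta(S)| : delta(S) :&: B = F }  (default #|E| is never
   used when F is cut-induced, and is an upper bound anyway) *)
Definition qcut (B F : {set E}) : nat :=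
  \big[minn/#|E|]_(S : {set V} | delta S :&: B == F) #|delta S|.

Variable R : realType.

(* net current leaving v under potential phi, every edge copy a unit resistor *)
Definition outflow (phi : V -> R) (v : V) : R :=
  \sum_(e : E) ((if src e == v then phi v - phi (dst e) else 0)
               + (if dst e == v then phi v - phi (src e) else 0)).

Definition unit_potential (s t : V) (phi : V -> R) : Prop :=
  phi s = 1 /\ phi t = 0 /\
  forall v, v != s -> v != t -> outflow phi v = 0.

(* "c_e >= K": the effective conductance (current from s to t under unit
   voltage) of the edge e = st is at least K.  The current is independent of
   the choice of potential (and such a potential exists). *)
Definition eff_conductance_ge (e : E) (K : R) : Prop :=
  forall phi, unit_potential (src e) (dst e) phi -> K <= outflow phi (src e).

End Graph.

(* Main.v *)
(* Karger's random contraction argument, run on weighted graphs in which the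
   hypothesis "conductance at least K" reads K (phi s - phi t)^2 <= energy phi
   for every potential phi.  A vertex v meeting no edge of B is eliminated by
   the star-mesh transformation: the new energy is the minimum of the old one
   over phi v, so the hypothesis survives and no cut gets heavier.  Once every
   vertex meets B, every degree is at least K, so the total weight is at least
   n K / 2, and contracting an edge chosen with probability proportional to its
   weight keeps a cut of weight at most alpha K with probability at least
   1 - 2 alpha / n.  Writing 2 alpha = k + r with k integral and 0 <= r < 1,
   the bound n (n-1) ... (n-k+1) (n-k)^r satisfies the resulting recursion
   for n > k and is at most n^(2 alpha). *)
Require Import Defs.
From HB Require Import structures.
From mathcomp Require Import all_boot all_order all_algebra.
From mathcomp Require Import ring lra zify.
From mathcomp Require Import reals exp.
Import Order.TTheory GRing.Theory Num.Theory.
Local Open Scope ring_scope.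
Set Implicit Arguments.
Unset Strict Implicit.
Unset Printing Implicit Defensive.

(** * Bernoulli's inequality and the numerical recursion *)

Lemma bernoulli_powR_le (R : realType) (x r : R) :
  0 <= x -> 0 <= r <= 1 -> x `^ r <= 1 + r * (x - 1).
Proof.
move=> x0 /andP[]; rewrite le_eqVlt => /predU1P[<- _|r0].
  by rewrite powRr0 mul0r addr0.
rewrite le_eqVlt => /predU1P[->|r1]; first by rewrite powRr1//; lra.
have s0 : 0 < 1 - r by lra.
(* Young's inequality for [x ^ r] and 1 with conjugate exponents 1/r and 1/(1-r). *)
have := @conjugate_powR R (x `^ r) 1 r^-1 (1 - r)^-1 (powR_ge0 _ _) ler01.
rewrite !invr_gt0 !invrK powR1 mulr1 -powRrM mulfV ?gt_eqF// powRr1//.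
by move=> /(_ r0 s0 _) H; have := H ltac:(lra); lra.
Qed.

(** Interpolates between the falling factorials of order k (at r = 0) and k + 1 (at r = 1). *)
Definition contraction_bound (R : realType) (k : nat) (r : R) (n : nat) : R :=
  (n ^_ k)%:R * (n - k)%N%:R `^ r.

Section ContractionBound.
Variables (R : realType) (k : nat) (r : R).
Hypothesis r01 : 0 <= r <= 1.
Local Notation h := (contraction_bound k r).

(** With m = n + 1 - k, the falling factorials cancel up to a factor m. What remains is m (m-1)^r <=
    (m-r) m^r, Bernoulli at x = (m-1)/m. *)
Lemma contraction_bound_step n : (k < n)%N ->
  n.+1%:R * h n <= (n.+1%:R - (k%:R + r)) * h n.+1.
Proof.
move=> kn; rewrite /contraction_bound subSn ?(ltnW kn)//.
have /(congr1 (fun m => m%:R : R)) : (n.+1 * n ^_ k = n.+1 ^_ k * (n - k).+1)%N.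
  by rewrite -ffactSS ffactnSr subSn ?(ltnW kn).
rewrite !natrM mulrA => ->.
have -> : n.+1%:R - (k%:R + r) = (n - k).+1%:R - r :> R.
  by rewrite -subSn ?(ltnW kn)// natrB ?(leqW (ltnW kn))//; ring.
rewrite [leRHS]mulrCA -mulrA ler_wpM2l ?ler0n//.
have m0 : 0 < (n - k).+1%:R :> R by rewrite ltr0n.
have := @bernoulli_powR_le R ((n - k)%:R / (n - k).+1%:R) r _ r01.
rewrite powRM ?invr_ge0 ?ler0n// divr_ge0 ?ler0n// => /(_ isT).
move=> /(ler_wpM2r (powR_ge0 (n - k).+1%:R r)).
rewrite -!mulrA -powRM ?invr_ge0 ?ler0n// mulVf ?gt_eqF// powR1 mulr1.
rewrite -(ler_pM2l m0) => /le_trans; apply.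
rewrite mulrA ler_wpM2r ?powR_ge0//.
rewrite -natr1 in m0 *.
by rewrite le_eqVlt; apply/orP; left; apply/eqP; field; rewrite gt_eqF.
Qed.

Lemma contraction_bound_homo : {homo h : m n / (m <= n)%N >-> m <= n}.
Proof.
move=> m n mn; rewrite /contraction_bound ler_pM ?ler0n ?powR_ge0//.
  rewrite ler_nat; elim: k => [//|j IH]; rewrite !ffactnSr leq_mul//.
  by rewrite leq_sub2r.
by rewrite ge0_ler_powR ?nnegrE ?ler0n ?ler_nat ?leq_sub2r//; case/andP: r01.
Qed.

Lemma contraction_bound_base : h k.+1 = (k.+1)`!%:R.
Proof.
by rewrite /contraction_bound subSnn powR1 mulr1 -ffactnn ffactnSr subSnn muln1.
Qed.

Lemma contraction_bound_le n : (k < n)%N -> h n <= n%:R `^ (k%:R + r).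
Proof.
move=> kn; have n0 : n%:R != 0 :> R by rewrite pnatr_eq0 -lt0n (leq_trans _ kn).
rewrite powRD ?n0 ?implybT// /contraction_bound ler_pM ?ler0n ?powR_ge0//.
  rewrite powR_mulrn ?ler0n// -natrX ler_nat.
  elim: k => [|j IH]; first by rewrite expn0.
  by rewrite ffactnSr expnSr leq_mul// leq_subr.
by rewrite ge0_ler_powR ?nnegrE ?ler0n ?ler_nat ?leq_subr//; case/andP: r01.
Qed.

End ContractionBound.

(** * Weighted graphs, energy, and star-mesh elimination *)

Section WeightedGraph.
Variables (R : realType) (V : finType).
Implicit Types (w : V -> V -> R) (A S : {set V}) (phi psi : V -> R).

(** Weights are directed: the conductance between x and y is [w x y + w y x]. On the indicator of S
    this is the weight of the cut inside A. *)
Definition energy w A phi : R :=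
  \sum_(x in A) \sum_(y in A) w x y * (phi x - phi y) ^+ 2.

Lemma energy_congr w A phi psi :
  {in A, phi =1 psi} -> energy w A phi = energy w A psi.
Proof.
by move=> e; apply: eq_bigr => x xA; apply: eq_bigr => y yA; rewrite !e.
Qed.

Definition current w A phi (x : V) : R :=
  \sum_(y in A) (w x y + w y x) * (phi x - phi y).

Definition star w v x : R := w v x + w x v.

Definition star_total w A v : R := \sum_(x in A :\ v) star w v x.

Definition star_mean w A v phi : R :=
  (\sum_(x in A :\ v) star w v x * phi x) / star_total w A v.

(** The usual mesh conductance [a x * a y / W] is shared by the two ordered pairs, hence the 2. The
    diagonal entries carry no energy. *)
Definition star_mesh w A v x y : R :=
  w x y + star w v x * star w v y / (2 * star_total w A v).

Definition extend (v : V) (t : R) phi x : R := if x == v then t else phi x.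

Section Elimination.
Variables (w : V -> V -> R) (A : {set V}) (v : V).
Hypotheses (w0 : forall x y, 0 <= w x y) (vA : v \in A).
Local Notation a := (star w v).
Local Notation W := (star_total w A v).

Lemma star_ge0 x : 0 <= a x. Proof. by rewrite addr_ge0. Qed.

Lemma star_total_ge0 : 0 <= W.
Proof. by apply: sumr_ge0 => x _; exact: star_ge0. Qed.

Lemma star_mesh_ge0 x y : 0 <= star_mesh w A v x y.
Proof.
by rewrite addr_ge0// divr_ge0 ?mulr_ge0 ?star_ge0 ?star_total_ge0.
Qed.

(** Settles the case of an isolated [v], where the quotients by W take their default value. *)
Lemma star_eq0 x : W = 0 -> x \in A :\ v -> a x = 0.
Proof.
by move=> W0; move: x; apply: psumr_eq0P => // x _; exact: star_ge0.
Qed.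

Lemma star_meanE phi :
  W * star_mean w A v phi = \sum_(x in A :\ v) a x * phi x.
Proof.
have [W0|W0] := eqVneq W 0; last by rewrite mulrC divfK.
by rewrite W0 mul0r big1// => x xA; rewrite star_eq0 ?mul0r.
Qed.

Lemma energy_split phi : energy w A phi =
  energy w (A :\ v) phi + \sum_(x in A :\ v) a x * (phi x - phi v) ^+ 2.
Proof.
rewrite /energy (big_setD1 v)//= (big_setD1 v)//= subrr expr0n mulr0 add0r.
under [X in _ + X]eq_bigr do rewrite (big_setD1 v)//=.
rewrite big_split/= addrA addrC -big_split/=; congr (_ + _).
by apply: eq_bigr => x _; rewrite /star; ring.
Qed.

(* Completing the square in [phi v]: the remainder is the variance of [phi]
   under the weights [a], which is the energy of the new mesh. *)
Lemma energy_eliminate phi : energy w A phi =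
  energy (star_mesh w A v) (A :\ v) phi
  + W * (phi v - star_mean w A v phi) ^+ 2.
Proof.
rewrite energy_split.
have -> : energy (star_mesh w A v) (A :\ v) phi = energy w (A :\ v) phi +
    \sum_(x in A :\ v) \sum_(y in A :\ v)
       a x * a y / (2 * W) * (phi x - phi y) ^+ 2.
  rewrite -big_split/=; apply: eq_bigr => x _; rewrite -big_split/=.
  by apply: eq_bigr => y _; rewrite mulrDl.
rewrite -addrA; congr (_ + _).
have [W0|W0] := eqVneq W 0.
  rewrite W0 mul0r addr0 big1 ?big1// => x xA; last by rewrite star_eq0 ?mul0r.
  by rewrite big1// => y _; rewrite star_eq0 ?mul0r.
set m := \sum_(x in A :\ v) a x * phi x.
set q := \sum_(x in A :\ v) a x * phi x ^+ 2.
have -> : \sum_(x in A :\ v) a x * (phi x - phi v) ^+ 2 =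
    q - 2 * phi v * m + phi v ^+ 2 * W.
  rewrite /q /m /star_total !mulr_sumr -sumrB -big_split/=.
  by apply: eq_bigr => x _; ring.
have -> : \sum_(x in A :\ v) \sum_(y in A :\ v)
    a x * a y / (2 * W) * (phi x - phi y) ^+ 2 =
    \sum_(x in A :\ v) (a x * phi x ^+ 2 / 2 - a x * phi x * (m / W)
                        + a x * (q / (2 * W))).
  apply: eq_bigr => x _.
  transitivity (\sum_(y in A :\ v) (a y * (a x * phi x ^+ 2 / (2 * W))
     - a y * phi y * (a x * phi x / W) + a y * phi y ^+ 2 * (a x / (2 * W)))).
    by apply: eq_bigr => y _; field.
  rewrite big_split/= sumrB -!mulr_suml -/m -/q -/W.
  by field.
rewrite big_split/= sumrB -!mulr_suml -/m -/q -/W /star_mean -/m.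
by field.
Qed.

Lemma energy_star_mesh_le phi :
  energy (star_mesh w A v) (A :\ v) phi <= energy w A phi.
Proof.
by rewrite energy_eliminate lerDl mulr_ge0 ?star_total_ge0 ?sqr_ge0.
Qed.

Lemma extend_eq t phi x : x != v -> extend v t phi x = phi x.
Proof. by rewrite /extend => /negbTE->. Qed.

(** The mean kills the square in [energy_eliminate], so the mesh energy is attained on the larger
    graph. Lower bounds on energy thus pass to the mesh. *)
Lemma energy_extend_mean phi :
  energy w A (extend v (star_mean w A v phi) phi) =
  energy (star_mesh w A v) (A :\ v) phi.
Proof.
have e : {in A :\ v, extend v (star_mean w A v phi) phi =1 phi}.
  by move=> x /setD1P[xv _]; rewrite extend_eq.
rewrite energy_eliminate (energy_congr _ e).
have -> : star_mean w A v (extend v (star_mean w A v phi) phi)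
          = star_mean w A v phi.
  by rewrite /star_mean; congr (_ / _); apply: eq_bigr => x xA; rewrite e.
by rewrite {1}/extend eqxx subrr expr0n mulr0 addr0.
Qed.

(** The current from x into [v] at the mean voltage splits as the sum of
    [a x * a y / W * (phi x - phi y)], the currents in the new mesh edges. *)
Lemma current_extend_mean phi x : x \in A :\ v ->
  current w A (extend v (star_mean w A v phi) phi) x =
  current (star_mesh w A v) (A :\ v) phi x.
Proof.
move=> xA; have /setD1P[xv _] := xA.
rewrite /current (big_setD1 v)//= {2}/extend eqxx !extend_eq// addrC.
rewrite [LHS](_ : _ = \sum_(y in A :\ v) (w x y + w y x) * (phi x - phi y)
    + a x * (phi x - star_mean w A v phi)); last first.
  rewrite /star [w v x + _]addrC; congr (_ + _); apply: eq_bigr => y.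
  by move=> /setD1P[yv _]; rewrite !extend_eq.
have -> : a x * (phi x - star_mean w A v phi) =
    \sum_(y in A :\ v) a x * a y / W * (phi x - phi y).
  have [W0|W0] := eqVneq W 0.
    by rewrite star_eq0 ?mul0r// big1// => y _; rewrite !mul0r.
  rewrite /star_mean.
  transitivity (\sum_(y in A :\ v) (a y * (a x / W * phi x)
                 - a y * phi y * (a x / W))).
    by rewrite sumrB -!mulr_suml -/W; field.
  by apply: eq_bigr => y _; field.
rewrite -big_split/=; apply: eq_bigr => y _; rewrite /star_mesh.
rewrite invfM; lra.
Qed.

Lemma current_mean phi :
  current w A (extend v (star_mean w A v phi) phi) v = 0.
Proof.
rewrite /current (big_setD1 v)//= subrr mulr0 add0r.
transitivity (\sum_(y in A :\ v) (a y * star_mean w A v phi - a y * phi y)).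
  apply: eq_bigr => y /setD1P[yv _].
  by rewrite {1}/extend eqxx extend_eq// mulrBr.
by rewrite sumrB -mulr_suml -/W star_meanE subrr.
Qed.

End Elimination.

(** Eliminate a vertex other than s and t, solve the mesh, and restore the vertex at its mean
    voltage. Existence matters because [eff_conductance_ge] quantifies over all unit potentials. *)
Lemma harmonic_exists w A (s t : V) : (forall x y, 0 <= w x y) -> s != t ->
  exists phi, [/\ phi s = 1, phi t = 0 &
    forall x, x \in A -> x != s -> x != t -> current w A phi x = 0].
Proof.
move=> + st; have [n] := ubnP #|A|; elim: n A w => // n IH A w An w0.
have [/existsP[v /and3P[vA vs vt]]|/existsPn none] :=
    boolP [exists v, [&& v \in A, v != s & v != t]]; last first.
  exists (fun x => (x == s)%:R); split => [||x xA xs xt].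
  - by rewrite eqxx.
  - by rewrite eq_sym (negbTE st).
  - by have := none x; rewrite xA xs xt.
have [||phi [phis phit harm]] := IH (A :\ v) (star_mesh w A v).
- by move: An; rewrite (cardsD1 v) vA; lia.
- exact: star_mesh_ge0.
exists (extend v (star_mean w A v phi) phi); split.
- by rewrite extend_eq// eq_sym.
- by rewrite extend_eq// eq_sym.
- move=> x xA xs xt; have [->|xv] := eqVneq x v; first exact: current_mean.
  by rewrite current_extend_mean// ?harm// !inE xv.
Qed.

End WeightedGraph.

(** * Dirichlet's principle: from conductance to energy *)

Section Contraction.
Variables (R : realType) (V E : finType).
Implicit Types (w : V -> V -> R) (A S : {set V}) (phi psi : V -> R).
Implicit Types (src dst : E -> V) (B F : {set E}).

Definition indic S (x : V) : R := (x \in S)%:R.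

Lemma energy_ge0 w A phi : (forall x y, 0 <= w x y) -> 0 <= energy w A phi.
Proof.
move=> w0; apply: sumr_ge0 => x _; apply: sumr_ge0 => y _.
by rewrite mulr_ge0 ?sqr_ge0.
Qed.

(** Summation by parts; the right side is the bilinear form that polarizes [energy]. *)
Lemma energy_form w A phi psi :
  \sum_(x in A) phi x * current w A psi x =
  \sum_(x in A) \sum_(y in A) w x y * ((phi x - phi y) * (psi x - psi y)).
Proof.
transitivity (\sum_(x in A) \sum_(y in A) w x y * phi x * (psi x - psi y)
            + \sum_(x in A) \sum_(y in A) w y x * phi x * (psi x - psi y)).
  rewrite -big_split/=; apply: eq_bigr => x _; rewrite mulr_sumr -big_split/=.
  by apply: eq_bigr => y _; ring.
rewrite [X in _ + X]exchange_big/= -big_split/=; apply: eq_bigr => x _.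
by rewrite -big_split/=; apply: eq_bigr => y _; ring.
Qed.

(* Dirichlet's principle: [phi - lam psi] takes equal values at [s] and [t],
   so it is orthogonal to [psi] for the energy form. *)
Lemma conductance_energy w (s t : V) (K : R) :
  (forall x y, 0 <= w x y) -> s != t ->
  (forall psi, psi s = 1 -> psi t = 0 ->
    (forall x, x != s -> x != t -> current w setT psi x = 0) ->
    K <= current w setT psi s) ->
  forall phi, K * (phi s - phi t) ^+ 2 <= energy w setT phi.
Proof.
move=> w0 st cK phi.
have [psi [psis psit harm]] := harmonic_exists setT w0 st.
have {}harm x : x != s -> x != t -> current w setT psi x = 0.
  by apply: harm; rewrite inE.
have formE chi : \sum_(x in setT) chi x * current w setT psi x =
    chi s * current w setT psi s + chi t * current w setT psi t.
  have tS : t \in [set: V] :\ s by rewrite !inE eq_sym st.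
  rewrite (big_setD1 s) ?inE//= (big_setD1 t tS)/= addrA.
  rewrite [X in _ + X]big1 ?addr0// => x.
  by rewrite !inE => /and3P[xt xs _]; rewrite harm ?mulr0.
(* Testing against the constant 1 gives conservation of current. *)
have sum0 : current w setT psi s + current w setT psi t = 0.
  have := formE (fun=> 1); rewrite !mul1r => <-; rewrite energy_form.
  by rewrite big1// => x _; rewrite big1// => y _; rewrite subrr mul0r mulr0.
set lam := phi s - phi t.
pose chi x := phi x - lam * psi x.
have -> : energy w setT phi = energy w setT chi
   + lam * 2 * (\sum_(x in setT) chi x * current w setT psi x)
   + lam ^+ 2 * (\sum_(x in setT) psi x * current w setT psi x).
  rewrite !energy_form !mulr_sumr -!big_split/=; apply: eq_bigr => x _.
  rewrite !mulr_sumr -!big_split/=; apply: eq_bigr => y _.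
  by rewrite /chi; ring.
rewrite !formE psis psit.
have -> : chi t = chi s by rewrite /chi psis psit /lam; ring.
rewrite -mulrDr sum0 !mulr0 addr0 mul0r addr0 mul1r.
rewrite ler_wpDl ?energy_ge0// mulrC ler_wpM2l ?sqr_ge0//.
exact: cK.
Qed.

(** * Traces of light cuts under elimination and merging *)

Definition pushforward (pi : V -> V) w A x y : R :=
  \sum_(a in A | pi a == x) \sum_(b in A | pi b == y) w a b.

Lemma pushforward_ge0 pi w A :
  (forall x y, 0 <= w x y) -> forall x y, 0 <= pushforward pi w A x y.
Proof. by move=> w0 x y; apply: sumr_ge0 => a _; apply: sumr_ge0. Qed.

(** Merging restricts the energy to potentials constant on the fibres of [pi], so bounds valid for
    every potential survive. *)
Lemma energy_pushforward pi w A A' phi : {in A, forall x, pi x \in A'} ->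
  energy (pushforward pi w A) A' phi = energy w A (phi \o pi).
Proof.
move=> piA; rewrite /energy [RHS](partition_big pi (mem A'))//=.
apply: eq_bigr => x _.
transitivity (\sum_(a in A | pi a == x) \sum_(y in A')
  \sum_(b in A | pi b == y) w a b * (phi x - phi y) ^+ 2).
  rewrite exchange_big/=; apply: eq_bigr => y _; rewrite mulr_suml.
  by apply: eq_bigr => a _; rewrite mulr_suml.
apply: eq_bigr => a /andP[_ /eqP ax].
rewrite [RHS](partition_big pi (mem A'))//=; apply: eq_bigr => y _.
by apply: eq_bigr => b /andP[_ /eqP ->]; rewrite ax.
Qed.

(** Loops are exempt: merging creates them, and they cross no cut. *)
Definition conductive w A src dst B (K : R) : Prop :=
  forall e, e \in B -> src e != dst e ->
  [/\ src e \in A, dst e \in A &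
      forall phi, K * (phi (src e) - phi (dst e)) ^+ 2 <= energy w A phi].

(** Edges keep their names while [src], [dst] and A change, so the families of a graph and of its
    reductions are comparable as sets. *)
Definition cut_family w A src dst B (c : R) : {set {set E}} :=
  [set F : {set E} | (F != set0) &&
    [exists S : {set V}, (delta src dst S :&: B == F) &&
                         (energy w A (indic S) <= c)]].

Lemma cut_familyP w A src dst B c F :
  reflect (F != set0 /\ exists S, delta src dst S :&: B = F /\
             energy w A (indic S) <= c)
          (F \in cut_family w A src dst B c).
Proof.
rewrite inE; apply: (iffP andP) => -[F0].
  by move=> /existsP[S /andP[/eqP]]; split=> //; exists S.
by move=> [S [/eqP SF cS]]; split=> //; apply/existsP; exists S; apply/andP.
Qed.

(** Extending a potential to [v] by the mean leaves its values at the ends of the non-loop edges of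
    B unchanged. *)
Lemma conductive_star_mesh w A src dst B K (v : V) :
  (forall x y, 0 <= w x y) -> v \in A -> conductive w A src dst B K ->
  {in B, forall e, src e != dst e -> (src e != v) && (dst e != v)} ->
  conductive (star_mesh w A v) (A :\ v) src dst B K.
Proof.
move=> w0 vA cK Bv e eB ne; have /andP[sv dv] := Bv e eB ne.
have [sA dA cKe] := cK e eB ne; split=> [||phi]; rewrite ?inE ?sv ?dv//.
rewrite -energy_extend_mean//; apply: le_trans (cKe _).
by rewrite !extend_eq.
Qed.

Lemma cut_family_star_mesh w A src dst B c (v : V) :
  (forall x y, 0 <= w x y) -> v \in A ->
  cut_family w A src dst B c \subset
  cut_family (star_mesh w A v) (A :\ v) src dst B c.
Proof.
move=> w0 vA; apply/subsetP => F /cut_familyP[F0 [S [SF cS]]].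
apply/cut_familyP; split=> //; exists S; split=> //.
by apply: le_trans cS; exact: energy_star_mesh_le.
Qed.

Definition merge_vertex (u v x : V) : V := if x == v then u else x.

Lemma merge_vertex_in A u v : u \in A -> u != v ->
  {in A, forall x, merge_vertex u v x \in A :\ v}.
Proof.
move=> uA uv x xA; rewrite /merge_vertex; case: (eqVneq x v) => [_|xv].
  by rewrite !inE uv.
by rewrite !inE xv.
Qed.

Section Merge.
Variables (w : V -> V -> R) (A : {set V}) (src dst : E -> V) (B : {set E}).
Variables (u v : V).
Hypotheses (uA : u \in A) (uv : u != v).
Local Notation m := (merge_vertex u v).
Local Notation w' := (pushforward m w A).

Lemma conductive_merge K : conductive w A src dst B K ->
  conductive w' (A :\ v) (m \o src) (m \o dst) B K.
Proof.
move=> cK e eB ne; have ne' : src e != dst e.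
  by apply: contraNneq ne => /= ->.
have [sA dA cKe] := cK e eB ne'.
split=> [||phi] /=; rewrite ?merge_vertex_in//.
by rewrite energy_pushforward//; [exact: cKe|exact: merge_vertex_in].
Qed.

Lemma cut_family_merge S c : (u \in S) = (v \in S) ->
  delta src dst S :&: B != set0 -> energy w A (indic S) <= c ->
  delta src dst S :&: B \in
    cut_family w' (A :\ v) (m \o src) (m \o dst) B c.
Proof.
move=> uvS F0 cS.
have mS x : (m x \in S) = (x \in S).
  by rewrite /merge_vertex; case: eqP => [->|].
apply/cut_familyP; split=> //; exists S; split.
  by apply/setP => e; rewrite !inE !mS.
rewrite energy_pushforward; last exact: merge_vertex_in.
by rewrite (@energy_congr _ _ _ _ _ (indic S))// => x _; rewrite /indic /= mS.
Qed.

End Merge.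

(* A cut and its complement have the same trace on [B], so only vertex sets
   avoiding one fixed vertex have to be counted. *)
Lemma card_cut_family w A src dst B K c : A != set0 ->
  conductive w A src dst B K ->
  (#|cut_family w A src dst B c| < 2 ^ #|A|.-1)%N.
Proof.
move=> /set0Pn[a aA] cK; set F := cut_family _ _ _ _ _ _.
have sub : F \subset
    [set delta src dst S :&: B | S in powerset (A :\ a)] :\ set0.
  apply/subsetP => X /cut_familyP[X0 [S [SX _]]].
  rewrite in_setD1 X0 -SX /=.
  (* Non-loop edges of B have both ends in A, so S may be cut down to A. *)
  pose S' := if a \in S then A :\: S else A :&: S.
  apply/imsetP; exists S'.
    rewrite inE; apply/subsetP => x; rewrite /S'.
    case: ifP => aS; rewrite !inE => /andP[xS xA].
      by rewrite xA andbT; apply: contraNneq xS => ->.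
    by rewrite xS andbT; apply: contraTneq xA => ->; rewrite aS.
  apply/setP => e; rewrite !inE; case eB: (e \in B); rewrite ?andbF// !andbT.
  have [->|ne] := eqVneq (src e) (dst e); first by rewrite !eqxx.
  have [sA dA _] := cK e eB ne.
  rewrite /S'; case: ifP => _; rewrite !inE sA dA ?andbT//.
  by case: (_ \in S); case: (_ \in S).
(* The empty trace is counted by the powerset but excluded from the family, which makes the bound
   strict. *)
have s0 : set0 \in [set delta src dst S :&: B | S in powerset (A :\ a)].
  apply/imsetP; exists set0; first by rewrite inE sub0set.
  by apply/setP => e; rewrite !inE.
apply: (leq_ltn_trans (subset_leq_card sub)).
have := leq_imset_card (fun S => delta src dst S :&: B) (powerset (A :\ a)).
rewrite card_powerset (cardsD1 set0) s0 add1n => /leq_trans; apply.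
by rewrite (cardsD1 a A) aA.
Qed.

(** * Degrees, total weight and the averaging over contractions *)

Lemma sum_indic_sqr A (x y : V) : x \in A -> y \in A ->
  \sum_(v in A) (indic [set v] x - indic [set v] y) ^+ 2
  = 2 * (x != y)%:R :> R.
Proof.
move=> xA yA; have [<-|xy] := eqVneq x y.
  by rewrite mulr0 big1// => v _; rewrite subrr expr0n.
have yAx : y \in A :\ x by rewrite !inE eq_sym xy.
(* Only the singletons of x and y separate x from y. *)
rewrite (big_setD1 x)//= (big_setD1 y yAx)/= big1 => [|v].
  rewrite /indic !inE !eqxx (negbTE xy) eq_sym (negbTE xy).
  by rewrite subr0 sub0r sqrrN expr1n addr0 mulr1.
rewrite !inE => /and3P[vy vx _].
by rewrite /indic !inE eq_sym (negbTE vx) eq_sym (negbTE vy) subrr expr0n.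
Qed.

(** Loop weights are dropped: contracting a loop would not remove a vertex. *)
Definition weight w A : R :=
  \sum_(x in A) \sum_(y in A) w x y * (x != y)%:R.

Lemma handshake w A :
  \sum_(v in A) energy w A (indic [set v]) = 2 * weight w A.
Proof.
rewrite /weight mulr_sumr exchange_big/=; apply: eq_bigr => x xA.
rewrite mulr_sumr exchange_big/=; apply: eq_bigr => y yA.
by rewrite -mulr_sumr sum_indic_sqr// mulrCA.
Qed.

(** The indicator of [v], as test potential, changes by 1 across e. *)
Lemma degree_ge w A src dst B K (v : V) e : conductive w A src dst B K ->
  e \in B -> src e != dst e -> (src e == v) || (dst e == v) ->
  K <= energy w A (indic [set v]).
Proof.
move=> cK eB ne ev; have [_ _ /(_ (indic [set v]))] := cK e eB ne.
rewrite /indic !inE; case/orP: ev => /eqP ev; rewrite ev eqxx.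
  by rewrite -ev eq_sym (negbTE ne) subr0 expr1n mulr1.
by rewrite -ev (negbTE ne) sub0r sqrrN expr1n mulr1.
Qed.

Lemma weight_sub_cut w A S : weight w A - energy w A (indic S) =
  \sum_(x in A) \sum_(y in A)
    w x y * ((x != y) && ((x \in S) == (y \in S)))%:R.
Proof.
rewrite -sumrB; apply: eq_bigr => x _; rewrite -sumrB; apply: eq_bigr => y _.
rewrite -mulrBr; congr (_ * _); rewrite /indic.
have [<-|_] := eqVneq x y; first by rewrite eqxx; ring.
by case: (x \in S); case: (y \in S) => /=; ring.
Qed.

(* Contracting a random edge, chosen with probability proportional to its
   weight, destroys a given cut with probability at most [c / weight]. *)
Lemma contraction_average w A src dst B (c H : R) :
  (forall x y, 0 <= w x y) ->
  {in A &, forall u v, u != v ->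
    #|cut_family (pushforward (merge_vertex u v) w A) (A :\ v)
        (merge_vertex u v \o src) (merge_vertex u v \o dst) B c|%:R <= H} ->
  #|cut_family w A src dst B c|%:R * (weight w A - c) <= weight w A * H.
Proof.
move=> w0 HH; set F := cut_family w A src dst B c.
pose F' u v := cut_family (pushforward (merge_vertex u v) w A) (A :\ v)
        (merge_vertex u v \o src) (merge_vertex u v \o dst) B c.
have sur X : X \in F -> weight w A - c <=
    \sum_(x in A) \sum_(y in A) w x y * ((x != y) && (X \in F' x y))%:R.
  move=> /cut_familyP[X0 [S [SX cS]]].
  apply: (@le_trans _ _ (weight w A - energy w A (indic S))).
    by rewrite lerD2l lerN2.
  rewrite weight_sub_cut; apply: ler_sum => x xA; apply: ler_sum => y yA.
  rewrite ler_wpM2l// ler_nat; case: eqP => //= /eqP xy.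
  case: eqP => //= xyS; rewrite -SX cut_family_merge ?SX//.
(* Double counting: sum [sur] over X, then bound by H the number of X surviving each merge. *)
rewrite mulrC mulr_natr -sumr_const (le_trans (ler_sum _ sur))//.
rewrite exchange_big/= /weight mulr_suml; apply: ler_sum => x xA.
rewrite exchange_big/= mulr_suml; apply: ler_sum => y yA.
rewrite -mulr_sumr -mulrA ler_wpM2l//; case: eqP => [_|/eqP xy] /=.
  by rewrite big1// mul0r.
rewrite mul1r (le_trans _ (HH _ _ xA yA xy))// -natr_sum ler_nat.
rewrite -big_mkcondr/= sum1_card subset_leq_card//.
by apply/subsetP => X /andP[].
Qed.

(** The [+ 1] yields the strict inequality at the end. It survives the recursion because n + 1 - 2
    alpha <= n + 1. *)
Lemma cut_family_bound (B : {set E}) (k : nat) (r alpha K : R) n :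
  (2 <= k)%N -> 0 <= r <= 1 -> 2 * alpha = k%:R + r -> 0 < K -> (k < n)%N ->
  forall w A src dst, #|A| = n -> (forall x y, 0 <= w x y) ->
  conductive w A src dst B K ->
  #|cut_family w A src dst B (alpha * K)|%:R + 1 <= contraction_bound k r n.
Proof.
move=> k2 r01 akr K0; elim: n => // n IH kn w A src dst An w0 cK.
have A0 : A != set0 by rewrite -card_gt0 An.
move: kn; rewrite ltnS leq_eqVlt => /predU1P[kn|kn].
  (* At k + 1 vertices the trivial count is below 2^k, and 2^k <= (k+1)!. *)
  rewrite -kn contraction_bound_base natr1 ler_nat.
  apply: leq_trans (card_cut_family _ A0 cK) _.
  rewrite An -kn /=; elim: k {k2 akr kn IH} => // k IH.
  by rewrite factS expnS leq_mul.
have Hn := contraction_bound_homo k r01 (leqnSn n).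
have [/existsP[v /andP[vA /forall_inP Bv]]|/existsPn Bv] :=
  boolP [exists v, (v \in A) &&
    [forall e in B, (src e != dst e) ==> (src e != v) && (dst e != v)]].
  (* Elimination only enlarges the family; monotonicity in n absorbs the lost vertex. *)
  apply: le_trans Hn; have := IH kn (star_mesh w A v) (A :\ v) src dst.
  have Avn : #|A :\ v| = n by move: An; rewrite (cardsD1 v) vA => -[].
  move=> /(_ Avn (star_mesh_ge0 A v w0)) H; apply: le_trans (H _).
    by rewrite lerD2r ler_nat subset_leq_card// cut_family_star_mesh.
  by apply: conductive_star_mesh => // e eB; apply/implyP/Bv.
have deg : K * n.+1%:R <= 2 * weight w A.
  rewrite -handshake mulr_natr -An -sumr_const; apply: ler_sum => v vA.
  have := Bv v; rewrite vA /= => /forall_inPn[e eB].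
  rewrite negb_imply => /andP[ne]; rewrite negb_and !negbK.
  exact: degree_ge cK eB ne.
have avg : #|cut_family w A src dst B (alpha * K)|%:R
    * (weight w A - alpha * K) <= weight w A * (contraction_bound k r n - 1).
  apply: contraction_average => // u v uA vA uv; rewrite lerBrDr; apply: IH.
  - exact: kn.
  - by move: An; rewrite (cardsD1 v) vA => -[].
  - exact: pushforward_ge0.
  - exact: conductive_merge.
have step := contraction_bound_step r01 kn.
have [r0 r1] := andP r01.
set N := #|_|%:R in avg *; set W := weight w A in deg avg.
set h := contraction_bound k r n in avg step.
set h' := contraction_bound k r n.+1 in step *.
(* Here n + 1 >= k + 2 and r <= 1, so this factor can be cancelled. *)
have m0 : 0 < n.+1%:R - (k%:R + r) :> R.
  have : k.+2%:R <= n.+1%:R :> R by rewrite ler_nat.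
  by rewrite -2!natr1; lra.
have k0 : 0 <= k%:R :> R by [].
have W0 : 0 < W.
  have : 0 < K * n.+1%:R by rewrite mulr_gt0.
  lra.
have N0 : 0 <= N by rewrite ler0n.
rewrite -lerBrDr -(ler_pM2l m0) -(ler_pM2l W0).
(* The destruction probability [alpha * K / W] is at most 2 alpha / (n + 1). *)
have a1 : n.+1%:R * (alpha * K) <= (k%:R + r) * W.
  have : 0 <= alpha * (2 * W - K * n.+1%:R).
    by rewrite mulr_ge0// ?subr_ge0//; lra.
  by rewrite -akr; lra.
have a2 : N * (n.+1%:R * W - (k%:R + r) * W) <= n.+1%:R * (W * (h - 1)).
  apply: le_trans (ler_wpM2l _ avg); last by rewrite ler0n.
  by rewrite mulrCA ler_wpM2l// mulrBr lerD2l lerN2.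
have a3 : W * (n.+1%:R * h) <= W * ((n.+1%:R - (k%:R + r)) * h').
  by rewrite ler_wpM2l// ltW.
have a4 : 0 <= W * (k%:R + r) by rewrite mulr_ge0 ?addr_ge0 // ltW.
lra.
Qed.

End Contraction.

(** * The multigraph as a weighted graph, one unit per edge copy *)

Section Multigraph.
Variables (R : realType) (V E : finType) (src dst : E -> V).

Definition edge_weight (x y : V) : R :=
  \sum_(e : E | (src e == x) && (dst e == y)) 1.

Lemma edge_weight_ge0 x y : 0 <= edge_weight x y.
Proof. by apply: sumr_ge0. Qed.

Lemma sum_edge_weight (g : V -> V -> R) :
  \sum_(x in [set: V]) \sum_(y in [set: V]) edge_weight x y * g x y =
  \sum_e g (src e) (dst e).
Proof.
rewrite [RHS](partition_big src (mem [set: V])) => [|e _]; last by rewrite inE.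
apply: eq_bigr => x _.
rewrite [RHS](partition_big dst (mem [set: V])) => [|e _]; last by rewrite inE.
apply: eq_bigr => y _; rewrite mulr_suml; apply: eq_bigr => e.
by case/andP => /eqP-> /eqP->; rewrite mul1r.
Qed.

Lemma energy_edge_weight phi :
  energy edge_weight setT phi = \sum_e (phi (src e) - phi (dst e)) ^+ 2.
Proof. exact: sum_edge_weight. Qed.

Lemma energy_indic_edge_weight (S : {set V}) :
  energy edge_weight setT (indic R S) = #|delta src dst S|%:R.
Proof.
rewrite energy_edge_weight -sum1_card natr_sum [RHS]big_mkcond/=.
apply: eq_bigr => e _; rewrite inE /indic.
by case: (src e \in S); case: (dst e \in S);
  rewrite /= ?subrr ?expr0n// ?subr0 ?sub0r ?sqrrN expr1n.
Qed.

Lemma outflow_edge_weight (phi : V -> R) v :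
  outflow src dst phi v = current edge_weight setT phi v.
Proof.
(* A double sum over ordered pairs is the form to which [sum_edge_weight] applies. *)
have splitE : current edge_weight setT phi v =
    \sum_(x in [set: V]) \sum_(y in [set: V]) edge_weight x y *
      ((if x == v then phi v - phi y else 0)
       + (if y == v then phi v - phi x else 0)).
  transitivity (\sum_(x in [set: V]) \sum_(y in [set: V])
     edge_weight x y * (if x == v then phi v - phi y else 0) +
     \sum_(x in [set: V]) \sum_(y in [set: V])
     edge_weight x y * (if y == v then phi v - phi x else 0)).
    rewrite (big_setD1 v) ?inE//= [X in _ + X + _]big1 ?addr0; last first.
      move=> x /setD1P[/negbTE xv _].
      by rewrite big1// => y _; rewrite xv mulr0.
    rewrite eqxx exchange_big/= [X in _ + X](big_setD1 v) ?inE//=.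
    rewrite [X in _ + (_ + X)]big1 ?addr0; last first.
      move=> x /setD1P[/negbTE xv _].
      by rewrite big1// => y _; rewrite xv mulr0.
    rewrite eqxx -big_split/=; apply: eq_bigr => y _.
    by rewrite mulrDl.
  rewrite -big_split/=; apply: eq_bigr => x _; rewrite -big_split/=.
  by apply: eq_bigr => y _; rewrite mulrDr.
rewrite splitE; symmetry.
exact: (sum_edge_weight (fun x y => (if x == v then phi v - phi y else 0)
                          + (if y == v then phi v - phi x else 0))).
Qed.

Lemma conductive_edge_weight (B : {set E}) (K : R) :
  (forall e, e \in B -> src e != dst e -> eff_conductance_ge src dst e K) ->
  conductive edge_weight setT src dst B K.
Proof.
move=> cK e eB ne; split; rewrite ?inE//.
apply: conductance_energy => [x y|//|psi psis psit harm].
  exact: edge_weight_ge0.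
rewrite -outflow_edge_weight; apply: (cK e eB ne).
by split=> //; split=> // x xs xt; rewrite outflow_edge_weight harm.
Qed.

(** If the minimum equals its default [#|E|], any S inducing F works, since no cut has more edges;
    hence an inequality. *)
Lemma qcut_attained (B F : {set E}) : cut_induced src dst B F ->
  exists2 S, delta src dst S :&: B = F
           & (#|delta src dst S| <= qcut src dst B F)%N.
Proof.
move=> /andP[_ /existsP[S0 S0F]].
have : qcut src dst B F = #|E| \/
    exists2 S, delta src dst S :&: B == F & #|delta src dst S| = qcut src dst B F.
  rewrite /qcut; elim/big_rec: _ => [|S m SF IH]; first by left.
  by case: leqP => _; [right; exists S|exact: IH].
case=> [->|[S /eqP SF <-]]; last by exists S.
by exists S0; [exact/eqP|rewrite max_card].
Qed.

Lemma cut_induced_family (B : {set E}) (c : R) :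
  [set F : {set E} | cut_induced src dst B F && ((qcut src dst B F)%:R <= c)]
    \subset cut_family edge_weight setT src dst B c.
Proof.
apply/subsetP => F; rewrite inE => /andP[Fcut Fc].
have [S SF qS] := qcut_attained Fcut.
apply/cut_familyP; split; first by case/andP: Fcut.
exists S; split=> //; apply: le_trans Fc.
by rewrite energy_indic_edge_weight ler_nat.
Qed.

End Multigraph.

(** * Small vertex sets and conclusion *)

Lemma exp2_pred_le_powR (R : realType) (n : nat) (p : R) :
  (0 < n)%N -> n%:R <= p -> (2 ^ n.-1)%:R <= n%:R `^ p.
Proof.
move=> n0 np; apply: (@le_trans _ _ (n%:R `^ n%:R)).
  rewrite powR_mulrn// -natrX ler_nat; case: n n0 {np} => [//|[//|n]] _.
  by rewrite (leq_trans (leq_pexp2l _ (leqnSn _)))// leq_exp2r.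
by rewrite ler_powR// ler1n.
Qed.

Unset Implicit Arguments.

Theorem theorem3p2 (R : realType) (V E : finType) (src dst : E -> V)
  (B : {set E}) (K alpha : R) :
  (0 < #|V|)%N ->
  0 < K ->
  (forall e, e \in B -> src e != dst e -> eff_conductance_ge src dst e K) ->
  1 <= alpha ->
  (#|[set F : {set E} | cut_induced src dst B F &&
        ((qcut src dst B F)%:R <= alpha * K)]|)%:R
    < (#|V|%:R : R) `^ (2 * alpha).
Proof.
move=> V0 K0 /conductive_edge_weight cK a1.
have /subset_leq_card := @cut_induced_family R V E src dst B (alpha * K).
rewrite -(ler_nat R) => /le_lt_trans; apply.
have p0 : 0 <= 2 * alpha by lra.
set k := Num.trunc (2 * alpha); pose r := 2 * alpha - k%:R.
have akr : 2 * alpha = k%:R + r by rewrite /r; ring.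
have /andP[kp pk] := truncn_itv p0; rewrite -/k in kp pk.
have k2 : (2 <= k)%N by rewrite truncn_ge_nat//; lra.
have r01 : 0 <= r <= 1 by move: pk; rewrite /r -natr1; lra.
(* With at most k <= 2 alpha vertices, outside the range of the recursion, the trivial count below
   2^(n-1) suffices. *)
have [kn|nk] := ltnP k #|V|; last first.
  apply: (@lt_le_trans _ _ (2 ^ #|V|.-1)%:R).
    rewrite ltr_nat -cardsT; apply: card_cut_family cK.
    by rewrite -card_gt0 cardsT.
  by apply: exp2_pred_le_powR => //; apply: le_trans kp; rewrite ler_nat.
have := cut_family_bound k2 r01 akr K0 kn (cardsT V)
          (edge_weight_ge0 _ _ _) cK.
have := contraction_bound_le r01 kn; rewrite -akr; lra.
Qed.
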